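(* For all positive integers $n,m$ and every integer $1\le k<m$, the exact quantum query complexity of $h_{k,n,m}$ satisfies $Q_E(h_{k,n,m})=O\!\left(n\sqrt{m/k}+kn+m\right)$.
   Context: Let $n,m$ be positive integers, $1\le k<m$ an integer, $M=[n]\times[m]$ (a grid of cells with $n$ rows and $m$ columns), $\tilde M=M\cup\{\bot\}$ (pointers to cells, $\bot$ the null pointer). Let $T$ be the following fixed binary tree with $m$ leaves and $m-1$ internal nodes: if $m=2^r$, $T$ is the complete binary tree with $2^r$ leaves; if $2^r<m<2^{r+1}$, take the complete binary tree with $2^r$ leaves and add a pair of children to each of its $m-2^r$ leftmost leaves. Outgoing arcs are labeled 'left'/'right', leaves labeled $1,\dots,m$ from left to right, and $T(j)$ is the sequence of labels on the root-to-leaf-$j$ path. The alphabet is $\Sigma=\{0,1\}\times\tilde M\times\tilde M\times\tilde M$ with components $\mathrm{val},\mathrm{lpoint},\mathrm{rpoint},\mathrm{ipoint}$. The function $h_{k,n,m}\colon\Sigma^M\to\{0,1\}$ has $h_{k,n,m}(x)=1$ iff: (1) there are exactly $k$ columns $b_1,\dots,b_k$ with $\mathrm{val}(x_{i,b_s})=1$ for all $i\in[n]$, $s\in[k]$ (marked columns); (2) each marked column $b_s$ contains a unique cell $a_s$ with $x_{a_s}\ne(1,\bot,\bot,\bot)$ (special elements); (3) $\mathrm{ipoint}(x_{a_s})=a_{s+1}$ for $s\in[k-1]$, $\mathrm{ipoint}(x_{a_k})=a_1$, and $\mathrm{lpoint}(x_{a_s})=\mathrm{lpoint}(x_{a_t})$,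 $\mathrm{rpoint}(x_{a_s})=\mathrm{rpoint}(x_{a_t})$ for all $s,t\in[k]$; (4) for each non-marked column $j$, the path starting at a special element and following $\mathrm{lpoint},\mathrm{rpoint}$ as specified by $T(j)$ exists (no $\bot$ on it) and ends at a cell $\ell_j$ in column $j$ with $\mathrm{val}(x_{\ell_j})=0$. $Q_E(f)$ is the minimum number of queries of a quantum query algorithm (queries $O_x|c,p\rangle|w\rangle=|c,p+x_c\bmod|\Sigma|\rangle|w\rangle$, $\Sigma$ identified with $[|\Sigma|]$) outputting $f(x)$ with probability $1$ on every input. *)

(* Defs.v *)
From HB Require Import structures.
From mathcomp Require Import all_boot all_order all_algebra.
From mathcomp Require Import complex.
From mathcomp Require Import Rstruct.

Set Implicit Arguments.
Unset Strict Implicit.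
Unset Printing Implicit Defensive.

Import Order.TTheory GRing.Theory Num.Theory.
Local Open Scope ring_scope.

Definition CC : numClosedFieldType := (Rdefinitions.R)[i].

Section Quantum.
Variables (I S : finType).

(* basis of the state space: |c, p> |w>  with c in I, p in [|S|], w in [d] *)
Definition qbasis (d : nat) := (I * 'I_#|S| * 'I_d)%type.
Definition qdim (d : nat) := #|{: qbasis d}|.

(* the query oracle O_x |c,p>|w> = |c, p + x_c mod |S|>|w>, with S identified
   with [|S|] through the canonical bijection enum_rank *)
Definition oracle (d : nat) (x : {ffun I -> S}) : 'M[CC]_(qdim d) :=
  \matrix_(i, j)
    (let b' := (enum_val i : qbasis d) in
     let b  := (enum_val j : qbasis d) in
     ((b'.1.1 == b.1.1) && (b'.2 == b.2) &&
      (nat_of_ord b'.1.2 == (nat_of_ord b.1.2 + enum_rank (x b.1.1)) %% #|S|)%N)%:R).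

Definition adjmx (p q : nat) (A : 'M[CC]_(p, q)) : 'M[CC]_(q, p) :=
  (map_mx Num.conj A)^T.

Definition unitarymx (N : nat) (U : 'M[CC]_N) : Prop := U *m adjmx U = 1%:M.

Fixpoint qrun (d : nat) (U : nat -> 'M[CC]_(qdim d)) (psi0 : 'cV[CC]_(qdim d))
  (x : {ffun I -> S}) (t : nat) : 'cV[CC]_(qdim d) :=
  match t with
  | 0 => U 0%N *m psi0
  | t'.+1 => U t *m (oracle d x *m qrun U psi0 x t')
  end.

(* A T-query quantum algorithm: workspace dimension d, unit initial state psi0,
   unitaries U_0, ..., U_T, and a final measurement in the computational basis
   whose outcome b is interpreted as the output out b.  It computes f exactly
   if on every input it outputs f x with probability 1, i.e. every basis state
   with the wrong output has amplitude 0. (General measurements reduce to this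
   one by absorbing a unitary into U_T.) *)
Definition exact_query_alg (f : {ffun I -> S} -> bool) (T : nat) : Prop :=
  exists (d : nat) (psi0 : 'cV[CC]_(qdim d)) (U : nat -> 'M[CC]_(qdim d))
         (out : qbasis d -> bool),
    (adjmx psi0 *m psi0 = 1%:M) /\
    (forall t, (t <= T)%N -> unitarymx (U t)) /\
    (forall x i, out (enum_val i) != f x -> qrun U psi0 x T i 0 = 0).

End Quantum.

Definition is_QE (I S : finType) (f : {ffun I -> S} -> bool) (q : nat) : Prop :=
  exact_query_alg f q /\ (forall T, exact_query_alg f T -> (q <= T)%N).

Inductive btree := Leaf | Node of btree & btree.

(* complete binary tree of depth r whose e leftmost leaves (if any)
   get a pair of children *)
Fixpoint grown_tree (r e : nat) : btree :=
  match r with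
  | 0 => if (0 < e)%N then Node Leaf Leaf else Leaf
  | r'.+1 => Node (grown_tree r' (minn e (2 ^ r'))) (grown_tree r' (e - 2 ^ r'))
  end.

Definition tree_T (m : nat) : btree :=
  let r := trunc_log 2 m in grown_tree r (m - 2 ^ r).

Fixpoint leaf_paths (t : btree) : seq (seq bool) :=
  match t with
  | Leaf => [:: [::]]
  | Node l r => map (cons false) (leaf_paths l) ++ map (cons true) (leaf_paths r)
  end.

(* T(j) for the leaf j (0-indexed: leaf j+1 of the paper) *)
Definition T_path (m : nat) (j : 'I_m) : seq bool := nth [::] (leaf_paths (tree_T m)) j.

(* cells (i, j): row i in [n], column j in [m] (0-indexed) *)
Definition cell (n m : nat) := ('I_n * 'I_m)%type.
Definition ptr (n m : nat) := option (cell n m).   (* None = bot *)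
Definition sigma (n m : nat) := (bool * ptr n m * ptr n m * ptr n m)%type.

Definition sval n m (s : sigma n m) : bool := s.1.1.1.
Definition lpoint n m (s : sigma n m) : ptr n m := s.1.1.2.
Definition rpoint n m (s : sigma n m) : ptr n m := s.1.2.
Definition ipoint n m (s : sigma n m) : ptr n m := s.2.

Definition blank n m : sigma n m := (true, None, None, None).

Section H.
Variables (k n m : nat).
Variable x : {ffun cell n m -> sigma n m}.

Definition marked (j : 'I_m) : bool := [forall i : 'I_n, sval (x (i, j))].

Definition special (a : cell n m) : bool := marked a.2 && (x a != blank n m).

Definition follow (a : cell n m) (s : seq bool) : ptr n m :=
  foldl (fun oc b => if oc is Some c then
                       (if b then rpoint (x c) else lpoint (x c))
                     else None) (Some a) s.

Definition h_cond1 : bool := #|[set j : 'I_m | marked j]| == k.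

Definition h_cond2 : bool :=
  [forall j : 'I_m, marked j ==> (#|[set i : 'I_n | x (i, j) != blank n m]| == 1%N)].

Definition h_cond3 : bool :=
  [exists a : {ffun 'I_k -> cell n m},
     injectiveb a && [forall s, special (a s)] &&
     [forall s, ipoint (x (a s)) == Some (a (ordS s))]] &&
  [forall a, forall b, special a ==> special b ==>
     (lpoint (x a) == lpoint (x b)) && (rpoint (x a) == rpoint (x b))].

Definition h_cond4 : bool :=
  [forall j : 'I_m, ~~ marked j ==>
     [forall a, special a ==>
        match follow a (T_path j) with
        | Some l => (l.2 == j) && ~~ sval (x l)
        | None => false
        end]].

Definition h_fun : bool := [&& h_cond1, h_cond2, h_cond3 & h_cond4].
End H.

Definition h (k n m : nat) : {ffun cell n m -> sigma n m} -> bool := @h_fun k n m.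

(* Main.v *)
Require Import Defs.
From HB Require Import structures.
From mathcomp Require Import all_boot all_order all_algebra.
From mathcomp Require Import Rstruct.
From mathcomp Require Import perm complex boolp reals topology normedtype derive.
From mathcomp Require Import trigo zify ring lra.

(* Amplitude amplification over the columns, tuned so as to be exact, followed
   by a deterministic verification.

   Whether a column is marked is decided by reading its n cells.  If exactly k
   of the m columns are marked, the marked fraction k/m is known in advance; an
   extra bit lowers it to p = sin^2 t with t = pi / (2 (2 J + 1)), where J is of
   order sqrt (m/k), and then J rounds rotate the state exactly onto the marked
   columns.  Each round reads a column, flips a sign and unreads it.  From a
   marked column of an input x with h x = 1, reading that column, the tree below
   its special element and the k columns on the ipoint cycle yields a
   certificate for h x = 1, at the cost of n + 2m + kn queries.  So the
   algorithm accepts iff its transcript coincides with that of some accepted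
   input started from a marked column.  Such a transcript is never produced by
   an input with h x = 0, whatever superposition the search left behind. *)

Set Implicit Arguments.
Unset Strict Implicit.
Unset Printing Implicit Defensive.

Import Order.TTheory GRing.Theory Num.Theory.
Import numFieldNormedType.Exports.
Local Open Scope ring_scope.

(* The algebra library exports a different [unitarymx]. *)
Local Notation unitarymx := Defs.unitarymx.

(** * Circuits with oracle queries *)

Lemma adjmxM p q r (A : 'M[CC]_(p, q)) (B : 'M[CC]_(q, r)) :
  adjmx (A *m B) = adjmx B *m adjmx A.
Proof. by rewrite /adjmx map_mxM trmx_mul. Qed.

Lemma adjmxK p q (A : 'M[CC]_(p, q)) : adjmx (adjmx A) = A.
Proof. by apply/matrixP=> i j; rewrite !mxE conjCK. Qed.

Lemma unitarymx_adj N (U : 'M[CC]_N) : unitarymx U -> unitarymx (adjmx U).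
Proof. by rewrite /Defs.unitarymx adjmxK => /mulmx1C. Qed.

Lemma unitarymx_mul N (U V : 'M[CC]_N) :
  unitarymx U -> unitarymx V -> unitarymx (U *m V).
Proof.
rewrite /Defs.unitarymx adjmxM => hU hV.
by rewrite mulmxA -(mulmxA U) hV mulmx1.
Qed.

Lemma unitarymx1 N : unitarymx (1%:M : 'M[CC]_N).
Proof. by rewrite /Defs.unitarymx mul1mx /adjmx map_scalar_mx rmorph1 tr_scalar_mx. Qed.

Section Circuits.
Variables I S W : finType.
Local Notation N := (qdim I S #|W|).
Local Notation basis := (I * 'I_#|S| * W)%type.

Definition basis_of (i : 'I_N) : basis :=
  let b := enum_val i : qbasis I S #|W| in (b.1, enum_val b.2).

Definition index_of (e : basis) : 'I_N :=
  enum_rank ((e.1, enum_rank e.2) : qbasis I S #|W|).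

Lemma index_ofK : cancel index_of basis_of.
Proof. by case=> e w; rewrite /basis_of /index_of !enum_rankK. Qed.

Lemma basis_ofK : cancel basis_of index_of.
Proof.
move=> i; rewrite /basis_of /index_of /= enum_valK.
by rewrite -surjective_pairing enum_valK.
Qed.

Definition ket (e : basis) : 'cV[CC]_N := delta_mx (index_of e) 0.

Definition opmx (K : basis -> basis -> CC) : 'M[CC]_N :=
  \matrix_(i, j) K (basis_of i) (basis_of j).

Lemma sum_index_of (V : nmodType) (F : 'I_N -> V) :
  \sum_i F i = \sum_e F (index_of e).
Proof.
apply: reindex; apply: onW_bij.
by exists basis_of; [exact: index_ofK | exact: basis_ofK].
Qed.

Lemma ketE e i : ket e i 0 = (basis_of i == e)%:R.
Proof. by rewrite mxE eqxx andbT (can2_eq basis_ofK index_ofK). Qed.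

Lemma opmx_ket K e : opmx K *m ket e = \sum_e' K e' e *: ket e'.
Proof.
apply/matrixP=> i j; rewrite (ord1 j) {j} summxE mxE sum_index_of.
rewrite (bigD1 e) //= big1 ?addr0 => [|e' ne]; last first.
  by rewrite ketE index_ofK (negPf ne) mulr0.
rewrite (bigD1 (basis_of i)) //= big1 ?addr0 => [|e' ne]; last first.
  by rewrite mxE ketE eq_sym (negPf ne) mulr0.
by rewrite [opmx K _ _]mxE [RHS]mxE !ketE !index_ofK !eqxx !mulr1.
Qed.

Lemma ket_ext (A B : 'M[CC]_N) : (forall e, A *m ket e = B *m ket e) -> A = B.
Proof.
move=> eqAB; apply/matrixP=> i j; have := eqAB (basis_of j).
by rewrite /ket basis_ofK -!colE => /colP/(_ i); rewrite !mxE.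
Qed.

Lemma unitarymx_op K :
  (forall e1 e2, \sum_e (K e e1)^* * K e e2 = (e1 == e2)%:R) ->
  unitarymx (opmx K).
Proof.
move=> hK; apply: mulmx1C; apply/matrixP=> i j.
rewrite !mxE sum_index_of -(inj_eq (can_inj basis_ofK)) -hK.
by apply: eq_bigr => e _; rewrite !mxE index_ofK.
Qed.

Definition permop (f : basis -> basis) := opmx (fun e' e => (e' == f e)%:R).

Lemma permop_ket f e : permop f *m ket e = ket (f e).
Proof.
rewrite opmx_ket (bigD1 (f e)) //= eqxx scale1r big1 ?addr0 // => e' /negPf->.
by rewrite scale0r.
Qed.

Lemma unitarymx_perm f : injective f -> unitarymx (permop f).
Proof.
move=> injf; apply: unitarymx_op => e1 e2.
rewrite (bigD1 (f e1)) //= eqxx conjC1 mul1r big1 ?addr0 => [|e /negPf->].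
  by rewrite (inj_eq injf).
by rewrite conjC0 mul0r.
Qed.

Lemma shift_subproof (p q : 'I_#|S|) : ((p + q) %% #|S| < #|S|)%N.
Proof. by rewrite ltn_pmod // (leq_ltn_trans _ (ltn_ord p)). Qed.

Definition shift (p q : 'I_#|S|) := Ordinal (shift_subproof p q).

Lemma oracle_ket (x : {ffun I -> S}) c p w :
  oracle #|W| x *m ket (c, p, w) = ket (c, shift p (enum_rank (x c)), w).
Proof.
rewrite -[RHS](permop_ket
  (fun e => (e.1.1, shift e.1.2 (enum_rank (x e.1.1)), e.2)) (c, p, w)).
congr (_ *m _); apply/matrixP=> i j; rewrite !mxE; congr ((_ : bool)%:R).
rewrite !xpair_eqE /= (inj_eq enum_val_inj) -val_eqE /=.
by rewrite -!andbA; congr (_ && _); rewrite andbC.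
Qed.

(** Reversal is p -> |S| - 1 - p, and conjugating addition of q by it gives subtraction of q. Hence
    the inverse oracle is one oracle call between two reversals. *)
Lemma rev_shift (p q : 'I_#|S|) : rev_ord (shift (rev_ord (shift p q)) q) = p.
Proof.
apply: val_inj => /=; have := ltn_ord p; have := ltn_ord q.
move: #|S| (p : nat) (q : nat) => s {}p {}q hq hp.
have [lt|le] := ltnP (p + q) s.
  rewrite (modn_small lt).
  have -> : (s - (p + q).+1 + q = s - p.+1)%N by lia.
  by rewrite modn_small; lia.
have e1 : ((p + q) %% s = p + q - s)%N.
  by rewrite -[in LHS](subnK le) modnDr modn_small //; lia.
rewrite e1.
have -> : (s - (p + q - s).+1 + q = (s - p.+1) + s)%N by lia.
by rewrite modnDr modn_small; lia.
Qed.

Definition revop := permop (fun e => (e.1.1, rev_ord e.1.2, e.2)).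

Lemma unitarymx_revop : unitarymx revop.
Proof.
by apply/unitarymx_perm/inv_inj => -[[c p] w]; rewrite /= rev_ordK.
Qed.

Lemma revop_oracle x : revop *m (oracle #|W| x *m (revop *m oracle #|W| x)) = 1%:M.
Proof.
apply: ket_ext => -[[c p] w]; rewrite mul1mx -!mulmxA oracle_ket permop_ket /=.
by rewrite oracle_ket permop_ket /= rev_shift.
Qed.

(** The index counts queries. Operators are specified pointwise in [x], so composites can be
    rewritten without an equality of functions. *)
Inductive qcircuit : nat -> ({ffun I -> S} -> 'M[CC]_N) -> Prop :=
| QUnitary U A of unitarymx U & (forall x, A x = U) : qcircuit 0 A
| QQuery T A U B of qcircuit T A & unitarymx U &
    (forall x, B x = U *m (oracle #|W| x *m A x)) : qcircuit T.+1 B.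

Lemma qcircuit_const U : unitarymx U -> qcircuit 0 (fun=> U).
Proof. by move=> hU; apply: QUnitary hU _. Qed.

Lemma qcircuit_comp T1 T2 A B :
  qcircuit T1 A -> qcircuit T2 B -> qcircuit (T2 + T1) (fun x => B x *m A x).
Proof.
move=> hA; elim=> {T2 B} [V B hV eqB | T2 B V C _ IH hV eqC].
  rewrite add0n; case: hA => {T1 A} [U A hU eqA | T A U A' hA hU eqA'].
    by apply: (QUnitary (unitarymx_mul hV hU)) => x; rewrite eqA eqB.
  by apply: (QQuery hA (unitarymx_mul hV hU)) => x; rewrite eqA' eqB !mulmxA.
by apply: (QQuery IH hV) => x; rewrite eqC !mulmxA.
Qed.

Lemma qcircuit_oracle : qcircuit 1 (fun x => oracle #|W| x).
Proof.
apply: (QQuery (qcircuit_const (unitarymx1 _)) (unitarymx1 _)) => x.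
by rewrite mul1mx mulmx1.
Qed.

(** Uncomputation costs no more than computation, since each inverse oracle takes a single query. *)
Lemma qcircuit_inv T A : qcircuit T A ->
  exists2 B, qcircuit T B & forall x, B x *m A x = 1%:M.
Proof.
elim=> {T A} [U A hU eqA | T A U C _ [B hB eqB] hU eqC].
  exists (fun=> adjmx U); first exact/qcircuit_const/unitarymx_adj.
  by move=> x; rewrite eqA; exact: mulmx1C.
have hR := qcircuit_const unitarymx_revop.
exists (fun x => B x *m (revop *m (oracle #|W| x *m (revop *m adjmx U)))).
  have := qcircuit_comp (qcircuit_comp (qcircuit_comp (qcircuit_comp
    (qcircuit_const (unitarymx_adj hU)) hR) qcircuit_oracle) hR) hB.
  by rewrite !add0n !addn0 addn1.
move=> x; rewrite eqC.
have -> : forall X, B x *m (revop *m (oracle #|W| x *m (revop *m adjmx U))) *m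
   (U *m X) = B x *m (revop *m (oracle #|W| x *m (revop *m ((adjmx U *m U) *m X)))).
  by move=> t X; rewrite !mulmxA.
rewrite (mulmx1C hU) mul1mx -[RHS](eqB x).
have -> : forall X, B x *m (revop *m (oracle #|W| x *m (revop *m (oracle #|W| x *m X))))
   = B x *m ((revop *m (oracle #|W| x *m (revop *m oracle #|W| x))) *m X).
  by move=> t X; rewrite !mulmxA.
by rewrite revop_oracle mul1mx.
Qed.

Lemma qrun_circuit T A : qcircuit T A ->
  exists2 U : nat -> 'M[CC]_N, (forall t, (t <= T)%N -> unitarymx (U t)) &
    forall x psi, qrun U psi x T = A x *m psi.
Proof.
elim=> {T A} [U A hU eqA | T A V B _ [U hU eqU] hV eqB].
  by exists (fun=> U) => // x psi; rewrite eqA.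
exists (fun t => if (t <= T)%N then U t else V) => [t _ | x psi].
  by case: leqP => // /hU.
have eqrun t : (t <= T)%N ->
    qrun (fun t => if (t <= T)%N then U t else V) psi x t = qrun U psi x t.
  elim: t => [|t IH] //= lt; rewrite lt IH //; exact: ltnW.
by rewrite /= ltnn eqrun // eqU eqB !mulmxA.
Qed.

End Circuits.

(** * Reversible simulation of decision trees *)

Inductive dtree (I S : Type) : Type :=
| Stop
| Ask of I & (S -> dtree I S).
Arguments Stop {I S}.

Section DecisionTrees.
Variables (I S : finType) (c0 : I).
Implicit Types (t : dtree I S) (x y : {ffun I -> S}).

Definition root t : I := if t is Ask c _ then c else c0.

Definition child t (v : S) : dtree I S := if t is Ask _ k then k v else Stop.

Definition next t (vs : seq S) : I := root (foldl child t vs).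

(* A tree that stops early is padded with dummy queries at [c0]. *)
Fixpoint transcript x t D : seq S :=
  if D is D'.+1 then x (root t) :: transcript x (child t (x (root t))) D' else [::].

Fixpoint depth_le t D : Prop :=
  match t, D with
  | Stop, _ => True
  | Ask _ _, 0 => False
  | Ask _ k, D'.+1 => forall v, depth_le (k v) D'
  end.

(** The path is the one taken by [x]: this says that [y] gives the same answers on every cell that
    [x] makes the tree read. *)
Fixpoint agree x y t : Prop :=
  if t is Ask c k then y c = x c /\ agree x y (k (x c)) else True.

Lemma size_transcript x t D : size (transcript x t D) = D.
Proof. by elim: D t => //= D IH t; rewrite IH. Qed.

Lemma transcriptS x t D :
  transcript x t D.+1 = rcons (transcript x t D) (x (next t (transcript x t D))).
Proof. by elim: D t => [|D IH] t //; rewrite [LHS]/= -/(transcript _ _ D.+1) IH. Qed.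

(** Equal answers keep both inputs on the same branch, and the depth bound ensures that [D] answers
    reach its end. *)
Lemma transcript_agree x y t D :
  depth_le t D -> transcript x t D = transcript y t D -> agree x y t.
Proof.
elim: D t => [|D IH] [|c k] //= hk [exy].
by rewrite exy => e; split=> //; exact: IH.
Qed.

Lemma depth_leW t D1 D2 : (D1 <= D2)%N -> depth_le t D1 -> depth_le t D2.
Proof.
elim: D1 D2 t => [|D1 IH] [|D2] [|c k] //= le12 hk v.
exact: IH le12 (hk v).
Qed.

End DecisionTrees.

Section Simulation.
Variables (I S G : finType) (K : nat) (c0 : I) (s0 : S).

Local Notation M := {ffun 'I_K -> 'I_#|S|}.
Local Notation W := (G * M)%type.

Definition zero_word : 'I_#|S| :=
  Ordinal (leq_ltn_trans (leq0n (enum_rank s0)) (ltn_ord (enum_rank s0))).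

Definition read_memory t (mem : M) : seq S :=
  [seq enum_val (mem i) | i <- take t (enum 'I_K)].

Definition memory_of (vs : seq S) : M :=
  [ffun i : 'I_K => if (i < size vs)%N then enum_rank (nth s0 vs i) else zero_word].

(** The resting state between queries: both query registers are reset and only the memory holds the
    answers, so the branches of a superposition can interfere again once the memory is cleared. *)
Definition state g vs : I * 'I_#|S| * W := (c0, zero_word, (g, memory_of vs)).

Lemma read_memory_of vs : (size vs <= K)%N -> read_memory (size vs) (memory_of vs) = vs.
Proof.
move=> le; have sz : size (take (size vs) (enum 'I_K)) = size vs.
  by rewrite size_takel // size_enum_ord.
apply: (@eq_from_nth _ s0); first by rewrite size_map sz.
move=> i; rewrite size_map sz => lt.
have ltK : (i < K)%N by apply: leq_trans le.
rewrite (nth_map (Ordinal ltK)) ?sz // nth_take // ffunE.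
by rewrite nth_enum_ord // lt enum_rankK.
Qed.

Definition swap_slot (t : nat) (e : I * 'I_#|S| * W) : I * 'I_#|S| * W :=
  let: (c, p, (g, mem)) := e in
  if insub t is Some i then
    (c, mem i, (g, [ffun j => if j == i then p else mem j]))
  else e.

Lemma swap_slotK t : involutive (swap_slot t).
Proof.
case=> [[c p] [g mem]] /=; case E: (insub t) => [i|] /=; last by rewrite E.
rewrite E ffunE eqxx; congr (_, _, (_, _)); apply/ffunP=> j; rewrite !ffunE.
by case: eqP => [->|].
Qed.

(** A transposition is used instead of an assignment so that the map is reversible, being its own
    inverse. The tree depends on [g], so each branch makes its own queries. *)
Definition load_query (tr : G -> dtree I S) (t : nat) (e : I * 'I_#|S| * W) :=
  let: (c, p, (g, mem)) := e in
  (tperm c0 (next c0 (tr g) (read_memory t mem)) c, p, (g, mem)).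

Lemma load_queryK tr t : involutive (load_query tr t).
Proof. by case=> [[c p] [g mem]] /=; rewrite tpermK. Qed.

Lemma shift0 q : shift zero_word q = q :> 'I_#|S|.
Proof. by apply: val_inj; rewrite /= add0n modn_small. Qed.

(** Load the next cell, query it, exchange the answer with the empty slot [t], and unload the
    cell. *)
Lemma simulation_step tr t x g : (t < K)%N ->
  permop (load_query tr t) *m (permop (swap_slot t) *m (oracle #|{: W}| x *m
    (permop (load_query tr t) *m ket (state g (transcript c0 x (tr g) t))))) =
  ket (state g (transcript c0 x (tr g) t.+1)).
Proof.
move=> lt; rewrite transcriptS; set vs := transcript _ _ _ _.
set c := next c0 (tr g) vs.
have szvs : size vs = t by rewrite size_transcript.
have rd : read_memory t (memory_of vs) = vs.
  by rewrite -{1}szvs read_memory_of // szvs ltnW.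
rewrite permop_ket /state /load_query rd -/c tpermL oracle_ket shift0.
rewrite permop_ket /swap_slot insubT ffunE /= szvs ltnn permop_ket.
set mem' := finfun _.
have memE : mem' = memory_of (rcons vs (x c)).
  apply/ffunP=> j; rewrite !ffunE size_rcons nth_rcons szvs -val_eqE /= ltnS.
  by case: (ltngtP (j : nat) t) => // ->; rewrite ltnn.
(* Unloading recomputes the same cell, because it reads only the first [t] slots, which the swap
   left alone. *)
have rd' : read_memory t mem' = vs.
  rewrite -[RHS]rd memE /read_memory; apply/eq_in_map => i.
  rewrite in_take ?mem_enum // index_enum_ord => lti.
  by rewrite !ffunE size_rcons nth_rcons szvs lti ltnS (ltnW lti).
by rewrite rd' -/c tpermR memE.
Qed.

Lemma simulation (tr : G -> dtree I S) t : (t <= K)%N ->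
  exists2 A, @qcircuit I S {: W} t A &
    forall x g, A x *m ket (state g [::]) = ket (state g (transcript c0 x (tr g) t)).
Proof.
elim: t => [|t IH] lt.
  exists (fun=> 1%:M); first exact/qcircuit_const/unitarymx1.
  by move=> x g; rewrite mul1mx.
have [A hA eqA] := IH (ltnW lt).
have uL := unitarymx_perm (inv_inj (@load_queryK tr t)).
have uS := unitarymx_perm (inv_inj (@swap_slotK t)).
have := qcircuit_comp (qcircuit_comp hA (qcircuit_const uL)) (qcircuit_oracle _ _ _).
move=> /qcircuit_comp/(_ (qcircuit_const (unitarymx_mul uL uS))) hB.
eexists; first exact: hB.
by move=> x g; rewrite -!mulmxA eqA simulation_step.
Qed.

End Simulation.

(** * Amplitude amplification *)

(** One round is a sign flip on [b] followed by the reflection 2|s><s| - 1. The ring is a parameter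
    so that amplitudes can be computed over the reals and then embedded into [CC]. *)
Fixpoint amplitude (F : pzRingType) (G : finType) (s : G -> F) (b : pred G)
    (j : nat) (g : G) : F :=
  if j is j'.+1 then
    2 * (\sum_g' s g' * ((-1) ^+ b g' * amplitude s b j' g')) * s g
      - (-1) ^+ b g * amplitude s b j' g
  else s g.

Section Search.
Variables (I S G : finType) (K : nat) (c0 : I) (s0 : S).
Variables (s : G -> CC).
Hypotheses (s_real : forall g, (s g)^* = s g) (s_unit : \sum_g s g ^+ 2 = 1).

Local Notation M := {ffun 'I_K -> 'I_#|S|}.
Local Notation W := (G * M)%type.
Local Notation st := (@state I S G K c0 s0).

Definition phase_kernel (n : nat) (good : G -> seq S -> bool)
    (e' e : I * 'I_#|S| * W) : CC :=
  (e' == e)%:R * (-1) ^+ good e.2.1 (read_memory n e.2.2).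

Definition diffusion_kernel (e' e : I * 'I_#|S| * W) : CC :=
  ((e'.1 == e.1) && (e'.2.2 == e.2.2))%:R
    * (2 * s e'.2.1 * s e.2.1 - (e'.2.1 == e.2.1)%:R).

Lemma unitarymx_phase n good : unitarymx (opmx (phase_kernel n good)).
Proof.
apply: unitarymx_op => e1 e2; rewrite (bigD1 e1) //= big1 ?addr0 => [|e ne].
  rewrite /phase_kernel eqxx mul1r rmorph_sign; case: eqP => [->|_].
    by rewrite mul1r -expr2 sqrr_sign.
  by rewrite mul0r mulr0.
by rewrite /phase_kernel (negPf ne) mul0r conjC0 mul0r.
Qed.

Lemma phase_ket n good g vs : (size vs = n)%N -> (n <= K)%N ->
  opmx (phase_kernel n good) *m ket (st g vs) = (-1) ^+ good g vs *: ket (st g vs).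
Proof.
move=> <- le; rewrite opmx_ket (bigD1 (st g vs)) //= big1 ?addr0 => [|e ne].
  by rewrite /phase_kernel eqxx mul1r /= read_memory_of.
by rewrite /phase_kernel (negPf ne) mul0r scale0r.
Qed.

Lemma sum_fiber (V : nmodType) (F : I * 'I_#|S| * W -> V) (e1 : I * 'I_#|S| * W) :
  \sum_(e | (e.1 == e1.1) && (e.2.2 == e1.2.2)) F e =
  \sum_g F (e1.1, (g, e1.2.2)).
Proof.
rewrite (reindex_onto (fun g => (e1.1, (g, e1.2.2))) (fun e => e.2.1)) /=.
  by apply: eq_bigl => g; rewrite !eqxx.
by case=> [cp [g mem]] /= /andP[/eqP-> /eqP->].
Qed.

Lemma unitarymx_diffusion : unitarymx (opmx diffusion_kernel).
Proof.
apply: unitarymx_op => e1 e2.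
rewrite (bigID (fun e => (e.1 == e1.1) && (e.2.2 == e1.2.2))) /=.
rewrite [X in _ + X]big1 ?addr0 => [|e /negPf ne]; last first.
  by rewrite /diffusion_kernel ne mul0r conjC0 mul0r.
rewrite sum_fiber /diffusion_kernel /=.
case: e1 e2 => [cp1 [g1 M1]] [cp2 [g2 M2]] /=; rewrite !eqxx !xpair_eqE /=.
under eq_bigr => g _ do rewrite mul1r rmorphB !rmorphM /= !s_real !rmorph_nat.
case: (boolP ((cp1 == cp2) && (M1 == M2))) => [/andP[/eqP-> /eqP->]|ne]; last first.
  rewrite big1 => [|g _]; last by rewrite mul0r mulr0.
  by move: ne; rewrite negb_and => /orP[/negPf->|/negPf->]; rewrite ?andbF.
rewrite !eqxx andbT /=.
(* Expand the product of two columns: as [s] has norm 1, the first three sums cancel as 4 - 2 - 2 =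
   0, leaving the identity. *)
pose B g : CC := (g == g1)%:R; pose C g : CC := (g == g2)%:R.
transitivity (4 * s g1 * s g2 * (\sum_g s g ^+ 2) - 2 * s g2 * (\sum_g s g * B g)
   - 2 * s g1 * (\sum_g s g * C g) + \sum_g B g * C g).
  rewrite !mulr_sumr -!sumrN -!big_split /=; apply: eq_bigr => g _.
  by rewrite /B /C; ring.
have sel (F : G -> CC) h : \sum_g F g * (g == h)%:R = F h.
  rewrite (bigD1 h) //= eqxx mulr1 big1 ?addr0 // => g /negPf->; exact: mulr0.
by rewrite s_unit /B /C !sel eq_sym; ring.
Qed.

Lemma diffusion_ket g vs :
  opmx diffusion_kernel *m ket (st g vs) =
  \sum_g' (2 * s g' * s g - (g' == g)%:R) *: ket (st g' vs).
Proof.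
rewrite opmx_ket.
rewrite (bigID (fun e => (e.1 == (st g vs).1) && (e.2.2 == (st g vs).2.2))) /=.
rewrite [X in _ + X]big1 ?addr0 => [|e /negPf ne]; last first.
  by rewrite /diffusion_kernel ne mul0r scale0r.
rewrite (sum_fiber _ (st g vs)) /=; apply: eq_bigr => g' _.
by rewrite /diffusion_kernel /= !eqxx mul1r.
Qed.

Variables (tr : G -> dtree I S) (n : nat) (good : G -> seq S -> bool).
Hypothesis le_nK : (n <= K)%N.

Definition good_at x g := good g (transcript c0 x (tr g) n).

(** Compute the transcript, flip the sign, uncompute; this is where the two [n] come from. *)
Lemma phase_circuit : exists2 A, @qcircuit I S {: W} (n + n) A &
  forall x g, A x *m ket (st g [::]) = (-1) ^+ good_at x g *: ket (st g [::]).
Proof.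
have [A hA eqA] := simulation c0 s0 tr le_nK.
have [B hB eqB] := qcircuit_inv hA.
have hP := qcircuit_const (unitarymx_phase n good).
have hBPA := qcircuit_comp (qcircuit_comp hA hP) hB; rewrite add0n in hBPA.
eexists; first exact: hBPA.
move=> x g; rewrite -!mulmxA eqA phase_ket ?size_transcript // -scalemxAr.
by rewrite -eqA mulmxA eqB mul1mx.
Qed.

Lemma amplification_circuit J : exists2 A, @qcircuit I S {: W} (J * (n + n)) A &
  forall x, A x *m (\sum_g s g *: ket (st g [::])) =
    \sum_g amplitude s (good_at x) J g *: ket (st g [::]).
Proof.
have [P hP eqP] := phase_circuit.
elim: J => [|J [A hA eqA]].
  exists (fun=> 1%:M); first exact/qcircuit_const/unitarymx1.
  by move=> x; rewrite mul1mx.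
have hD := qcircuit_const unitarymx_diffusion.
have hDPA := qcircuit_comp (qcircuit_comp hA hP) hD; rewrite add0n -mulSn in hDPA.
eexists; first exact: hDPA.
move=> x; rewrite -!mulmxA eqA !mulmx_sumr.
set a := amplitude s (good_at x) J.
pose b g : CC := (-1) ^+ good_at x g * a g.
transitivity (\sum_g \sum_g' (b g * (2 * s g' * s g - (g' == g)%:R)) *: ket (st g' [::])).
  apply: eq_bigr => g _; rewrite -!scalemxAr eqP -scalemxAr scalerA diffusion_ket.
  by rewrite scaler_sumr mulrC; apply: eq_bigr => g' _; rewrite scalerA.
rewrite exchange_big /=; apply: eq_bigr => g _; rewrite -scaler_suml; congr (_ *: _).
rewrite (eq_bigr (fun i => 2 * s g * (s i * b i) - b i * (g == i)%:R)) => [|i _]; last first.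
  by rewrite mulrBr; congr (_ - _); ring.
rewrite sumrB -mulr_sumr [2 * s g * _]mulrAC; congr (_ - _).
rewrite (bigD1 g) //= eqxx mulr1 big1 ?addr0 // => g' ne.
by rewrite eq_sym (negPf ne) mulr0.
Qed.

End Search.

(** The search returns with empty memory, so the verification reuses the same slots. Every final
    basis state of non-zero amplitude records some [g] together with its verification transcript,
    from which [acc] decides the answer. *)
Theorem exact_search (I S G : finType) (c0 : I) (s0 : S) (s : G -> CC)
    (trm trv : G -> dtree I S) (n D J : nat)
    (good acc : G -> seq S -> bool) (f : {ffun I -> S} -> bool) :
  (forall g, (s g)^* = s g) -> \sum_g s g ^+ 2 = 1 ->
  (forall x g,
     amplitude s (fun g' => good g' (transcript c0 x (trm g') n)) J g != 0 ->
     acc g (transcript c0 x (trv g) D) = f x) ->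
  exact_query_alg f (D + J * (n + n)).
Proof.
move=> s_real s_unit acc_f; pose K := maxn n D.
pose W := (G * {ffun 'I_K -> 'I_#|S|})%type.
pose st := @state I S G K c0 s0.
have [A hA eqA] :=
  amplification_circuit c0 s0 s_real s_unit trm good (leq_maxl n D : (n <= K)%N) J.
have [B hB eqB] := simulation c0 s0 trv (leq_maxr n D : (D <= K)%N).
have [U hU eqU] := qrun_circuit (qcircuit_comp hA hB).
pose out (b : qbasis I S #|{: W}|) :=
  let w : W := enum_val b.2 in acc w.1 (read_memory D w.2).
exists #|{: W}|, (\sum_g s g *: ket (st g [::])), U, out; split; [|split=> //].
- apply/matrixP=> i j; rewrite !ord1 !mxE eqxx -[RHS]s_unit sum_index_of.
  have ampE e : (\sum_g s g *: ket (st g [::])) (index_of e) 0 =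
      \sum_g s g * (e == st g [::])%:R.
    by rewrite summxE; apply: eq_bigr => g _; rewrite mxE ketE index_ofK.
  rewrite (eq_bigr (fun e => \sum_g (s g * (e == st g [::])%:R) *
      \sum_g' s g' * (e == st g' [::])%:R)) => [|e _]; last first.
    rewrite !mxE ampE -mulr_suml; congr (_ * _).
    by rewrite rmorph_sum; apply: eq_bigr => g _; rewrite rmorphM /= s_real rmorph_nat.
  rewrite exchange_big /=; apply: eq_bigr => g _.
  rewrite (bigD1 (st g [::])) //= [X in _ + X]big1 ?addr0 => [|e ne]; last first.
    by rewrite (negPf ne) mulr0 mul0r.
  rewrite eqxx mulr1 expr2 (bigD1 g) //= eqxx mulr1 big1 ?addr0 // => g' ne.
  by rewrite !xpair_eqE [g == g']eq_sym (negPf ne) /= andbF mulr0.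
- move=> x i; rewrite eqU -mulmxA eqA mulmx_sumr summxE => out_i.
  rewrite big1 // => g _; rewrite -scalemxAr eqB mxE ketE.
  case: eqP => [eqi|_]; last by rewrite mulr0.
  have [->|amp_g] := eqVneq (amplitude s (good_at c0 trm n good x) J g) 0.
    by rewrite mul0r.
  case/negP: out_i; apply/eqP; rewrite -(acc_f x g) //.
  move: eqi; rewrite /basis_of /out => -[_ ->] /=.
  by rewrite -{1}(size_transcript c0 x (trv g) D) read_memory_of // size_transcript leq_maxr.
Qed.

(** * Certificates for h *)

Section AskAll.
Variables (I S : finType).

Fixpoint ask_all (cs : seq I) (k : seq S -> dtree I S) : dtree I S :=
  if cs is c :: cs' then Ask c (fun v => ask_all cs' (fun vs => k (v :: vs)))
  else k [::].

Lemma depth_ask_all cs k N D : size cs = N ->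
  (forall vs, depth_le (k vs) D) -> depth_le (ask_all cs k) (N + D).
Proof. by move=> <-; elim: cs k => [|c cs IH] k hk //= v; apply: IH => vs; apply: hk. Qed.

Lemma agree_ask_all (x y : {ffun I -> S}) cs k : agree x y (ask_all cs k) ->
  {in cs, forall c, y c = x c} /\ agree x y (k [seq x c | c <- cs]).
Proof.
elim: cs k => [|c cs IH] k //= [yx /IH[yxs hk]]; split=> // c'.
by rewrite inE => /orP[/eqP-> | /yxs].
Qed.

Lemma transcript_ask_all c0 (x : {ffun I -> S}) cs k N : size cs = N ->
  transcript c0 x (ask_all cs k) N = [seq x c | c <- cs].
Proof. by move=> <-; elim: cs k => [|c cs IH] k //=; rewrite IH. Qed.

End AskAll.

Lemma leaf_paths_grown_tree r e : (size (leaf_paths (grown_tree r e)) <= 2 ^ r + e)%N.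
Proof.
elim: r e => [|r IH] e /=; first by case: e.
rewrite size_cat !size_map expnS.
have h1 := IH (minn e (2 ^ r)); have h2 := IH (e - 2 ^ r)%N; lia.
Qed.

Lemma leaf_paths_tree_T m : (0 < m)%N -> (size (leaf_paths (tree_T m)) <= m)%N.
Proof.
move=> m0; apply: leq_trans (leaf_paths_grown_tree _ _) _.
by rewrite subnKC // trunc_logP.
Qed.

(** * The verification tree and the certificate it reads *)

Section Verification.
Variables (k n m : nat) (c0 : cell n m).
Implicit Types (x y : {ffun cell n m -> sigma n m}).
Local Notation tree := (dtree (cell n m) (sigma n m)).

Definition ofollow x (oc : ptr n m) (p : seq bool) : ptr n m :=
  foldl (fun oc b => if oc is Some c then
                       (if b then rpoint (x c) else lpoint (x c))
                     else None) oc p.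

(** All root-to-leaf paths are followed together, so that shared prefixes are read once; a null
    pointer prunes its subtree. The continuation [next] is run after the whole traversal. *)
Fixpoint walk (t : btree) (oc : ptr n m) (next : tree) : tree :=
  if oc is Some c then
    match t with
    | Leaf => Ask c (fun=> next)
    | Node l r => Ask c (fun v => walk l (lpoint v) (walk r (rpoint v) next))
    end
  else next.

Lemma leaf_paths_gt0 t : (0 < size (leaf_paths t))%N.
Proof. by elim: t => //= l hl r hr; rewrite size_cat !size_map addn_gt0 hl. Qed.

(** A binary tree with L leaves has 2L - 1 nodes, and each costs at most one query. *)
Lemma depth_walk t oc next D : depth_le next D ->
  depth_le (walk t oc next) (2 * size (leaf_paths t) - 1 + D).
Proof.
move=> hn.
elim: t oc next D hn => [|l IHl r IHr] [c|] next D hn; first by move=> v; exact: hn.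
- exact: depth_leW hn.
- have hl := leaf_paths_gt0 l; have hr := leaf_paths_gt0 r.
  rewrite /= size_cat !size_map.
  set a := size (leaf_paths l) in IHl hl *; set b := size (leaf_paths r) in IHr hr *.
  have -> : (2 * (a + b) - 1 + D = (2 * a - 1 + (2 * b - 1 + D)).+1)%N by lia.
  by move=> v; apply/IHl/IHr.
- by apply: depth_leW hn; lia.
Qed.

Lemma ofollowN x p : ofollow x None p = None.
Proof. by elim: p. Qed.

Lemma agree_walk x y t oc next : agree x y (walk t oc next) ->
  agree x y next /\
  {in leaf_paths t, forall p, ofollow y oc p = ofollow x oc p /\
    forall l, ofollow x oc p = Some l -> y l = x l}.
Proof.
elim: t oc next => [|l IHl r IHr] [c|] next /=.
- case=> yx hn; split=> // p; rewrite inE => /eqP-> /=.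
  by split=> // _ [<-].
- by move=> hn; split=> // p _; rewrite !ofollowN.
- case=> yx /IHl[/IHr[hn hr] hl]; split=> // p; rewrite mem_cat.
  case/orP=> /mapP[q hq ->] /=; rewrite yx; [exact: hl | exact: hr].
- by move=> hn; split=> // p _; rewrite !ofollowN.
Qed.

Definition column (j : 'I_m) : seq (cell n m) := [seq (i, j) | i <- enum 'I_n].

Definition special_pos (vs : seq (sigma n m)) : nat :=
  find (predC1 (blank n m)) vs.

Fixpoint chain (q : nat) (j : 'I_m) : tree :=
  if q is q'.+1 then
    ask_all (column j) (fun vs =>
      if ipoint (nth (blank n m) vs (special_pos vs)) is Some c then chain q' c.2
      else Stop)
  else Stop.

Definition verify (j : 'I_m) : tree :=
  ask_all (column j) (fun vs =>
    walk (tree_T m) (Some (nth c0 (column j) (special_pos vs))) (chain k j)).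

Lemma size_column j : size (column j) = n.
Proof. by rewrite size_map size_enum_ord. Qed.

Lemma mem_column a j : (a \in column j) = (a.2 == j).
Proof.
apply/mapP/eqP => [[i _ -> //]|<-]; exists a.1; rewrite ?mem_enum //.
exact: surjective_pairing.
Qed.

Lemma depth_chain q j : depth_le (chain q j) (q * n).
Proof.
elim: q j => [|q IH] j //=; rewrite mulSn.
apply: depth_ask_all (size_column j) _ => vs; by case: ipoint => [c|] //; apply: IH.
Qed.

Lemma depth_verify j : (0 < m)%N -> depth_le (verify j) (n + (2 * m + k * n)).
Proof.
move=> m0; apply: depth_ask_all (size_column j) _ => vs.
apply: depth_leW (depth_walk _ _ (depth_chain k j)).
rewrite leq_add2r; have := leaf_paths_tree_T m0; lia.
Qed.

Lemma special_posP x a : x a != blank n m ->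
  (forall a', a'.2 = a.2 -> x a' != blank n m -> a' = a) ->
  let vs := [seq x c | c <- column a.2] in
  nth c0 (column a.2) (special_pos vs) = a /\
  nth (blank n m) vs (special_pos vs) = x a.
Proof.
move=> xa uniq_a vs.
have hvs : has (predC1 (blank n m)) vs.
  by apply/hasP; exists (x a) => //; apply: map_f; rewrite mem_column.
have lt : (special_pos vs < size (column a.2))%N.
  by rewrite -(size_map x) -has_find.
have nthE : nth (blank n m) vs (special_pos vs) = x (nth c0 (column a.2) (special_pos vs)).
  exact: nth_map.
have posE : nth c0 (column a.2) (special_pos vs) = a.
  apply: uniq_a; first by apply/eqP; rewrite -mem_column mem_nth.
  by rewrite -nthE; exact: (nth_find (blank n m) hvs).
by rewrite nthE posE.
Qed.

Lemma iter_ordS q (s : 'I_k) : iter q (@ordS k) s = ((s + q) %% k)%N :> nat.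
Proof.
elim: q => [|q IH] /=; first by rewrite addn0 modn_small.
by rewrite IH -addn1 modnDml addn1 addnS.
Qed.

(** Take q = s' - s modulo k. Thus a chain of [k] columns visits the whole cycle from any starting
    column. *)
Lemma ordS_reachable (s s' : 'I_k) : exists2 q, (q < k)%N & iter q (@ordS k) s = s'.
Proof.
have k0 : (0 < k)%N by apply: leq_ltn_trans (ltn_ord s).
exists ((s' + (k - s)) %% k)%N; first by rewrite ltn_pmod.
apply: val_inj; rewrite /= iter_ordS modnDmr addnCA subnKC ?modnDr ?modn_small //.
exact: ltnW.
Qed.

(* On an accepted input the verification reads a 1-certificate: all marked
   columns, and every cell on the tree paths to the unmarked columns. *)
Lemma verify_certificate x y b :
  h k x -> marked x b -> agree x y (verify b) -> h k y.
Proof.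
case/and4P=> /eqP card_x /forallP/= uniq_x /andP[/existsP/= [a]].
case/andP=> /andP[/injectiveP inj_a /forallP/= spec_a] /forallP/= cyc_a.
move=> /forallP/= same_x /forallP/= path_x mark_b hag.
have uniq_sp c c' : special x c -> special x c' -> c'.2 = c.2 -> c' = c.
  case: c c' => [i j] [i' j'] /andP[/= mj xc] /andP[/= _ xc'] ejj; subst j'.
  have /cards1P[i0 /setP ei] := implyP (uniq_x j) mj.
  have := ei i; have := ei i'; rewrite !inE xc xc'.
  by move=> /esym/eqP-> /esym/eqP->.
have uniq_at c : special x c ->
    forall c', c'.2 = c.2 -> x c' != blank n m -> c' = c.
  move=> sc c' ec xc'; apply: uniq_sp => //.
  by rewrite /special ec xc' andbT; case/andP: sc.
have marked_col j : marked x j -> exists s, j = (a s).2.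
  move=> mj; have := mj.
  (* The [k] special elements of the cycle lie in [k] distinct marked columns, and there are only
     [k] marked columns. *)
  have eq_set : [set (a s).2 | s : 'I_k] = [set j' | marked x j'].
    apply/eqP; rewrite eqEcard; apply/andP; split.
      by apply/subsetP=> _ /imsetP[s _ ->]; rewrite inE; case/andP: (spec_a s).
    rewrite card_x card_imset ?card_ord // => s s' /= e.
    exact/inj_a/(uniq_sp _ _ (spec_a s') (spec_a s) e).
  have : j \in [set j' | marked x j'] by rewrite inE.
  by rewrite -eq_set => /imsetP[s _ ->] _; exists s.
have [s0 eb] := marked_col b mark_b; subst b.
have chain_agree q s : agree x y (chain q (a s).2) -> forall i, (i < q)%N ->
    {in column (a (iter i (@ordS k) s)).2, forall c, y c = x c}.
  elim: q s => [|q IH] s //= /agree_ask_all[yx].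
  have /andP[_ xa] := spec_a s.
  have [_ ->] := special_posP xa (uniq_at _ (spec_a s)).
  rewrite (eqP (cyc_a s)) => /IH{}IH [|i] // lt c.
  by rewrite iterSr; apply: IH.
have /agree_ask_all[_ {hag}] := hag.
have /andP[_ xa0] := spec_a s0.
have [-> _ /agree_walk[/chain_agree{}chain_agree hwalk]] :=
  special_posP xa0 (uniq_at _ (spec_a s0)).
have yx_col c : marked x c.2 -> y c = x c.
  move=> /marked_col[s es]; have [q lt eqs] := ordS_reachable s0 s.
  by apply: (chain_agree _ lt); rewrite eqs mem_column es.
have path_cons j : ~~ marked x j -> forall c, special x c ->
    follow x c (T_path j) = follow x (a s0) (T_path j) /\
    follow y c (T_path j) = follow x c (T_path j) /\
    exists2 l, follow x c (T_path j) = Some l &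
      [/\ l.2 = j, Defs.sval (x l) = false & y l = x l].
  move=> nmj c sc; have := implyP (forallP (implyP (path_x j) nmj) c) sc.
  (* After its first step a path no longer depends on its special starting cell, as these share
     their left and right pointers. So the single walk from [a s0] covers all of them. *)
  have same z : special x z -> {in leaf_paths (tree_T m), forall p, p != [::] ->
      follow x z p = follow x (a s0) p /\ (follow y z p = follow y (a s0) p)}.
    move=> sz p _; case: p => [|d p] // _.
    have mz : marked x z.2 by case/andP: sz.
    have ma : marked x (a s0).2 by case/andP: (spec_a s0).
    have /andP[/eqP el /eqP er] :=
      implyP (implyP (forallP (same_x z) (a s0)) sz) (spec_a s0).
    by rewrite /follow /= !yx_col // el er.
  (* An empty path would end at the special cell itself, hence in a marked column. This also
     excludes the default value of [nth] in [T_path]. *)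
  case pE: (T_path j) => [|d p].
    rewrite /= => /andP[/eqP ej _]; case/negP: nmj; rewrite -ej.
    by case/andP: sc.
  have pin : d :: p \in leaf_paths (tree_T m).
    rewrite -pE; apply: mem_nth; rewrite ltnNge; apply/negP=> le.
    by move: pE; rewrite /T_path nth_default.
  have [sx sy] := same c sc _ pin isT.
  have [wy wx] := hwalk _ pin.
  rewrite sx sy; case E: (follow x (a s0) (d :: p)) => [l|//] /andP[/eqP ej /negbTE vl].
  split=> //; split; first by rewrite -E; exact: wy.
  by exists l => //; split=> //; exact: wx.
(* Marked columns were read entirely, and in each unmarked column the walk has read a cell of value
   0. *)
have markedE j : marked y j = marked x j.
  case mj: (marked x j).
    by apply/forallP=> i; rewrite yx_col //; exact: (forallP mj i).
  have [_ [_ [l _ [ej vl yl]]]] := path_cons j (negbT mj) _ (spec_a s0).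
  by apply/negbTE/forallPn; exists l.1; rewrite -ej -surjective_pairing yl vl.
have specialE c : special y c = special x c.
  by rewrite /special markedE; case mc: (marked x c.2) => //=; rewrite yx_col.
apply/and4P; split.
- rewrite /h_cond1 -card_x; apply/eqP/eq_card=> j.
  by rewrite !inE markedE.
- apply/forallP=> j /=; rewrite markedE; apply/implyP=> mj.
  rewrite -(eqP (implyP (uniq_x j) mj)); apply/eqP/eq_card=> i.
  by rewrite !inE yx_col.
- apply/andP; split.
    apply/existsP; exists a; apply/andP; split.
      apply/andP; split; first exact/injectiveP.
      by apply/forallP=> s; rewrite specialE.
    apply/forallP=> s /=; rewrite yx_col //; by case/andP: (spec_a s).
  apply/forallP=> c; apply/forallP=> c' /=; rewrite !specialE.
  apply/implyP=> sc; apply/implyP=> sc'.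
  have := implyP (implyP (forallP (same_x c) c') sc) sc'.
  by rewrite !yx_col //; [case/andP: sc' | case/andP: sc].
- apply/forallP=> j /=; rewrite markedE; apply/implyP=> nmj.
  apply/forallP=> c; rewrite specialE; apply/implyP=> sc.
  have [_ [-> [l -> [-> vl ->]]]] := path_cons j nmj c sc.
  by rewrite vl eqxx.
Qed.

End Verification.

(** * Exact rotation and query count *)

Lemma exists_is_QE (I S : finType) (f : {ffun I -> S} -> bool) T :
  exact_query_alg f T -> exists2 q, is_QE f q & (q <= T)%N.
Proof.
move=> hT; have ex : exists q, `[< exact_query_alg f q >].
  by exists T; apply/asboolP.
case: (ex_minnP ex) => q /asboolP hq qmin.
exists q; last by apply/qmin/asboolP.
by split=> // T' hT'; apply/qmin/asboolP.
Qed.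

Lemma amplitude_rmorph (F1 F2 : pzRingType) (phi : {rmorphism F1 -> F2})
    (G : finType) (s : G -> F1) (b : pred G) j g :
  amplitude (fun g => phi (s g)) b j g = phi (amplitude s b j g).
Proof.
elim: j g => [|j IH] g //=; rewrite IH.
under eq_bigr => g' _ do rewrite IH.
rewrite rmorphB !rmorphM rmorph_sum rmorph_sign rmorph_nat.
congr (_ * _ * _ - _); apply: eq_bigr => g' _.
by rewrite !rmorphM rmorph_sign.
Qed.

(** The rounds preserve the plane spanned by the good and bad parts of [s]; [u] and [v] are the
    coordinates there, and (1 - p) v - p u is the overlap with [s] after the sign flip. *)
Lemma amplitude_two_dim (F : comPzRingType) (G : finType) (s : G -> F)
    (b : pred G) (p : F) (u v : nat -> F) :
  \sum_g s g ^+ 2 = 1 -> \sum_(g | b g) s g ^+ 2 = p -> u 0%N = 1 -> v 0%N = 1 ->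
  (forall j, u j.+1 = 2 * ((1 - p) * v j - p * u j) + u j) ->
  (forall j, v j.+1 = 2 * ((1 - p) * v j - p * u j) - v j) ->
  forall j g, amplitude s b j g = s g * (if b g then u j else v j).
Proof.
move=> s1 sb u0 v0 uS vS; elim=> [|j IH] g /=.
  by rewrite u0 v0 if_same mulr1.
have snb : \sum_(g | ~~ b g) s g ^+ 2 = 1 - p.
  by rewrite -s1 [in RHS](bigID b) /= sb [in RHS]addrAC subrr add0r.
have -> : \sum_g' s g' * ((-1) ^+ b g' * amplitude s b j g') =
    (1 - p) * v j - p * u j.
  rewrite (bigID b) /= -snb -sb !mulr_suml addrC -sumrN; congr (_ + _).
    by apply: eq_bigr => g' /negPf nb; rewrite IH nb; ring.
  by apply: eq_bigr => g' bg; rewrite IH bg; ring.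
by rewrite IH uS vS; case: (b g); ring.
Qed.

Lemma sin_le_id (R : realType) (t : R) : 0 <= t -> sin t <= t.
Proof.
move=> t0; have [c _ eqc] : exists2 c, c \in `[0, t] & sin t - sin 0 = cos c * (t - 0).
  apply: MVT_segment => //. exact/continuous_subspaceT/continuous_sin.
move: eqc; rewrite sin0 !subr0 => ->.
by rewrite ler_piMl // cos_le1.
Qed.

(** Each round turns the angle by 2t, starting from t; the choice of t makes (2J + 1) t a right
    angle, so the bad coordinate vanishes exactly. The bound on [p] follows from sin t <= t and t J
    <= 1. *)
Lemma grover_rotation (R : realType) (J : nat) : (0 < J)%N ->
  exists p : R, exists u v : nat -> R,
    [/\ 0 <= p, p * J%:R ^+ 2 <= 1, u 0%N = 1, v 0%N = 1 & v J = 0] /\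
    forall j, u j.+1 = 2 * ((1 - p) * v j - p * u j) + u j /\
      v j.+1 = 2 * ((1 - p) * v j - p * u j) - v j.
Proof.
move=> J0; pose N : R := (2 * J + 1)%:R; pose t : R := pi / (2 * N).
have J1 : 1 <= J%:R :> R by rewrite ler1n.
have NE : N = 2 * J%:R + 1 by rewrite /N natrD natrM.
have pi0 := pi_gt0 R; have pi4 := pihalf_lt2 R.
have t0 : 0 < t by rewrite divr_gt0 // NE; lra.
have tpi : t < pi / 2 by rewrite /t ltr_pdivrMr NE; nra.
have S0 : 0 < sin t by apply: sin_gt0_pi; lra.
have C0 : 0 < cos t by apply: cos_gt0_pihalf; lra.
have St := sin_le_id (ltW t0).
exists (sin t ^+ 2).
exists (fun j => sin ((2 * j + 1)%:R * t) / sin t).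
exists (fun j => cos ((2 * j + 1)%:R * t) / cos t).
split.
  split.
  - exact: sqr_ge0.
  - have tJ : t * J%:R <= 1 by rewrite /t mulrAC ler_pdivrMr ?NE; nra.
    by rewrite -exprMn; apply: exprn_ile1; nra.
  - by rewrite mul1r divff // gt_eqF.
  - by rewrite mul1r divff // gt_eqF.
  - have -> : (2 * J + 1)%:R * t = pi / 2 
      by rewrite -/N /t invfM mulrCA [N * _]mulrCA mulfV ?mulr1 // pnatr_eq0 addn1.
    by rewrite cos_pihalf mul0r.
move=> j; set A := (2 * j + 1)%:R * t.
have -> : (2 * j.+1 + 1)%:R * t = A + t + t.
  by rewrite /A mulnS -addnA natrD; ring.
rewrite !(sinD, cosD); have := cos2Dsin2 t; move: S0 C0 => /lt0r_neq0 + /lt0r_neq0.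
move: (sin t) (cos t) (sin A) (cos A) => S C SA CA S0 C0 SC.
have -> : 1 - S ^+ 2 = C ^+ 2 by rewrite -SC; ring.
(* Inserting cos^2 + sin^2 = 1 makes both recurrences rational identities within reach of
   [field]. *)
have eqS : SA / S = SA / S * (C ^+ 2 + S ^+ 2) by rewrite SC mulr1.
have eqC : CA / C = CA / C * (C ^+ 2 + S ^+ 2) by rewrite SC mulr1.
by split; [rewrite [X in _ = _ + X]eqS | rewrite [X in _ = _ - X]eqC];
  field; rewrite S0 C0.
Qed.

Local Notation R := Rdefinitions.R.

(** * The algorithm for h and its cost *)

Lemma exact_search_real (I S G : finType) (c0 : I) (s0 : S) (r : G -> R)
    (trm trv : G -> dtree I S) (n D J : nat)
    (good acc : G -> seq S -> bool) (f : {ffun I -> S} -> bool) :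
  \sum_g r g ^+ 2 = 1 ->
  (forall x g,
     amplitude r (fun g' => good g' (transcript c0 x (trm g') n)) J g != 0 ->
     acc g (transcript c0 x (trv g) D) = f x) ->
  exact_query_alg f (D + J * (n + n)).
Proof.
move=> r1 acc_f; pose phi : {rmorphism R -> CC} := real_complex R.
apply: (@exact_search _ _ _ c0 s0 (fun g => phi (r g)) trm trv _ _ _ good acc).
- by move=> g; exact: conjc_real.
- by rewrite -(rmorph1 phi) -r1 rmorph_sum; apply: eq_bigr => g _; rewrite rmorphXn.
- by move=> x g; rewrite amplitude_rmorph fmorph_eq0; exact: acc_f.
Qed.

Lemma query_upper_bound (n m k J : nat) :
  (0 < n)%N -> (0 < k)%N -> (0 < m)%N -> (0 < J)%N -> m%:R <= k%:R * J%:R ^+ 2 :> R ->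
  exact_query_alg (@h k n m) (n + (2 * m + k * n) + J * (n + n)).
Proof.
move=> n0 k0 m0 J0 leJ.
pose c0 : cell n m := (Ordinal n0, Ordinal m0).
have [p [u [v [[p0 pJ u0 v0 vJ] uvS]]]] := grover_rotation R J0.
have mR : 0 < m%:R :> R by rewrite ltr0n.
have kR : 0 < k%:R :> R by rewrite ltr0n.
have JR : 0 < J%:R ^+ 2 :> R by rewrite exprn_gt0 // ltr0n.
have pm_le : p * m%:R <= k%:R.
  apply: le_trans (ler_wpM2l p0 leJ) _.
  by rewrite mulrCA -[leRHS]mulr1 ler_pM2l.
(* Each column has total weight 1/m, split by the extra bit into q and 1/m - q; the [k] marked
   columns with bit false then weigh exactly p. The hypothesis on [J] gives q <= 1/m. *)
pose q : R := p / k%:R.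
have q0 : 0 <= q by rewrite divr_ge0 // ltW.
have q1 : 0 <= m%:R^-1 - q.
  by rewrite subr_ge0 /q ler_pdivrMr // mulrC ler_pdivlMr.
pose r (g : 'I_m * bool) : R := Num.sqrt (if g.2 then m%:R^-1 - q else q).
have r2 g : r g ^+ 2 = if g.2 then m%:R^-1 - q else q.
  by rewrite /r sqr_sqrtr //; case: g.2.
have r1 : \sum_g r g ^+ 2 = 1.
  under eq_bigr => g _ do rewrite r2.
  rewrite -(pair_bigA _ (fun (_ : 'I_m) (a : bool) => if a then m%:R^-1 - q else q)) /=.
  under eq_bigr => j _ do rewrite big_bool /= subrK.
  by rewrite sumr_const card_ord -[_ *+ m]mulr_natr mulVf // gt_eqF.
pose good (g : 'I_m * bool) (vs : seq (sigma n m)) := ~~ g.2 && all (@Defs.sval n m) vs.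
pose trm (g : 'I_m * bool) : dtree (cell n m) (sigma n m) :=
  ask_all (column n g.1) (fun=> Stop).
pose D := (n + (2 * m + k * n))%N.
pose acc (g : 'I_m * bool) (vs : seq (sigma n m)) :=
  [exists y : {ffun cell n m -> sigma n m},
    [&& h k y, marked y g.1 & transcript c0 y (verify k c0 g.1) D == vs]].
apply: (@exact_search_real _ _ _ c0 (blank n m) r trm
          (fun g => verify k c0 g.1) _ _ _ good acc) => // x g.
have goodE g' : good g' (transcript c0 x (trm g') n) = ~~ g'.2 && marked x g'.1.
  rewrite /good /trm (transcript_ask_all _ _ _ (size_column n g'.1)); congr (_ && _).
  rewrite all_map; apply/allP/forallP => [hx i | hx c].
    by apply: (hx (i, g'.1)); rewrite mem_column.
  by case: c => i j; rewrite mem_column /= => /eqP->; apply: hx.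
(* If h x = 0, an accepting transcript would come from some accepted [y], and its certificate would
   force h x = 1, whatever the amplitudes. *)
have [hx|nhx] := boolP (h k x); last first.
  move=> _; apply/negbTE/existsPn => y; apply/negP => /and3P[hy my /eqP eqt].
  case/negP: nhx; apply: (verify_certificate (c0 := c0) hy my).
  exact: transcript_agree (depth_verify _ _ _ m0) eqt.
(* If h x = 1, the input witnesses its own acceptance once the column is marked, which holds because
   bad guesses have amplitude 0. *)
move=> amp_g; apply/existsP; exists x; rewrite hx eqxx andbT /=.
have sb : \sum_(g' | ~~ g'.2 && marked x g'.1) r g' ^+ 2 = p.
  under eq_bigr => g' _ do rewrite r2.
  rewrite big_mkcond -(pair_bigA _ (fun j a => if ~~ a && marked x j then
     (if a then m%:R^-1 - q else q) else 0)) /=.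
  under eq_bigr => j _ do rewrite big_bool /= add0r.
  rewrite -big_mkcond sumr_const /=; case/and4P: hx => /eqP card_x _ _ _.
  rewrite -[#|_|](_ : #|[set j | marked x j]| = _); last by apply: eq_card => j; rewrite inE.
  by rewrite card_x -[_ *+ k]mulr_natr divfK // gt_eqF.
move: amp_g; rewrite (amplitude_two_dim (p := p) (u := u) (v := v)) //.
- by rewrite goodE; case: ifP => [/andP[]|_] //; rewrite vJ mulr0 eqxx.
- by rewrite -sb; apply: eq_bigl => g'; rewrite goodE.
- by move=> j; have [] := uvS j.
- by move=> j; have [] := uvS j.
Qed.

(** The search costs 2nt + 2n <= 2nz + 2n; the 3n in total are absorbed by 3l, whence the constant
    4. *)
Lemma query_count_bound (F : realFieldType) (n m l t : nat) (z : F) :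
  (n <= l)%N -> t%:R <= z ->
  (n + (2 * m + l) + t.+1 * (n + n))%:R <= 4 * (n%:R * z + l%:R + m%:R).
Proof.
rewrite -(ler_nat F) => le_nl tz.
rewrite -addn1 !(natrD, natrM).
have tzn := ler_wpM2r (ler0n F n) tz.
have := mulr_ge0 (ler0n F t) (ler0n F n).
have := ler0n F n; have := ler0n F m; lra.
Qed.

Theorem theorem20 :
  exists C : Rdefinitions.R, 0 < C /\
    forall n m k : nat, (0 < n)%N -> (0 < m)%N -> (1 <= k)%N -> (k < m)%N ->
      exists q : nat, is_QE (@h k n m) q /\
        (q%:R <= C * (n%:R * Num.sqrt (m%:R / k%:R) + (k * n)%:R + m%:R)
          :> Rdefinitions.R).
Proof.
exists 4; split=> // n m k n0 m0 k0 _.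
have mk0 : 0 <= m%:R / k%:R :> R by rewrite divr_ge0.
(* J = floor(z) + 1 is positive and exceeds z, which gives m <= k J^2. *)
pose z : R := Num.sqrt (m%:R / k%:R); pose J := (Num.truncn z).+1.
have z0 : 0 <= z by exact: sqrtr_ge0.
have /andP[Jlo Jhi] := truncn_itv z0.
have leJ : m%:R <= k%:R * J%:R ^+ 2 :> R.
  have kR : 0 < k%:R :> R by rewrite ltr0n.
  rewrite mulrC -ler_pdivrMr // -(sqr_sqrtr mk0) ler_sqr ?nnegrE //; exact: ltW.
have [q hq leq_q] := exists_is_QE (query_upper_bound n0 k0 m0 (ltn0Sn _ : (0 < J)%N) leJ).
exists q; split=> //; rewrite -/z.
have le_q : q%:R <= (n + (2 * m + k * n) + J * (n + n))%:R :> R by rewrite ler_nat.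
by apply: le_trans le_q _; apply: query_count_bound => //; rewrite leq_pmull.
Qed.
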